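(* Let $k\geq 2$ be a fixed positive integer. For any positive integer $N$, there is a $k$-tree $G$ with $\mu_{int}(G) \geq N$.
   Context: All graphs are finite and simple. For a graph $G=(V,E)$ and a vertex $v\in V$, $E_v$ denotes the set of edges of $G$ incident with $v$. An edge coloring $c:E\to\mathbb{Z}$ (not necessarily proper) is called an improper interval edge coloring if for every $v\in V$ the image $c(E_v)$ is an integral interval, i.e. a set of consecutive integers. The interval coloring impropriety $\mu_{int}(G)$ is the smallest value $k'$ such that $G$ has an improper interval edge coloring $c$ in which at most $k'$ edges with a common endpoint have the same color, i.e. $|c^{-1}(i)\cap E_v|\leq k'$ for every color $i\in\mathbb{Z}$ and every vertex $v\in V$. A $k$-tree is defined recursively: the complete graph $K_{k+1}$ is a $k$-tree, and a $k$-tree on $n>k+1$ vertices is obtained from a $k$-tree on $n-1$ vertices by adding a new vertex and joining it to $k$ pairwise adjacent vertices (any such choice of $k$ vertices is allowed). *)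

(* Defs.v *)
From HB Require Import structures.
From mathcomp Require Import all_boot all_order all_algebra.
From mathcomp Require Import boolp.

Set Implicit Arguments.
Unset Strict Implicit.
Unset Printing Implicit Defensive.

Record sgraph := SGraph {
  vertex :> finType;
  adj : rel vertex;
  adj_sym : symmetric adj;
  adj_irrefl : irreflexive adj }.

Definition graph_iso (G H : sgraph) : Prop :=
  exists2 f : G -> H, bijective f & forall x y, adj (f x) (f y) = adj x y.

(* An edge is represented by the set of its two endpoints. *)
Definition edges (G : sgraph) : {set {set G}} :=
  [set e | [exists x, exists y, adj x y && (e == [set x; y])]].

Definition incident_edges (G : sgraph) (v : G) : {set {set G}} :=
  [set e in edges G | v \in e].

(* A finite set of integers is a set of consecutive integers exactly when it is
   order-convex; the empty set (at an isolated vertex) counts as an interval. *)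
Definition integral_interval (A : seq int) : Prop :=
  forall a b t : int, a \in A -> b \in A -> (a <= t <= b)%R -> t \in A.

(* A coloring is a function on all sets of vertices, of which only the values
   on edges are ever used. *)
Definition improper_interval_coloring (G : sgraph) (c : {set G} -> int) : Prop :=
  forall v : G, integral_interval [seq c e | e in incident_edges v].

Definition impropriety_at_most (G : sgraph) (c : {set G} -> int) (m : nat) : Prop :=
  forall (v : G) (i : int), #|[set e in incident_edges v | c e == i]| <= m.

Definition has_coloring_of_impropriety (G : sgraph) (m : nat) : Prop :=
  exists2 c : {set G} -> int,
    improper_interval_coloring c & impropriety_at_most c m.

(* A constant coloring is always an improper interval coloring, hence the
   minimum defining [mu_int] exists. *)
Lemma has_coloring_ex (G : sgraph) :
  exists m, `[< has_coloring_of_impropriety G m >].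
Proof.
exists #|edges G|; apply/asboolP; exists (fun=> 0%R).
  move=> v a b t /imageP[x xv ->] /imageP[y _ ->] /andP[t0 t1].
  have -> : t = 0%R by apply/eqP; rewrite Order.POrderTheory.eq_le t0 t1.
  by apply/imageP; exists x.
move=> v i; apply/subset_leq_card/fintype.subsetP => e.
by rewrite !inE => /andP[/andP[]].
Qed.

Definition mu_int (G : sgraph) : nat := ex_minn (has_coloring_ex G).

Definition complete_rel n : rel 'I_n := fun x y => x != y.

Lemma complete_sym n : symmetric (@complete_rel n).
Proof. by move=> x y; rewrite /complete_rel eq_sym. Qed.

Lemma complete_irrefl n : irreflexive (@complete_rel n).
Proof. by move=> x; rewrite /complete_rel eqxx. Qed.

Definition complete_graph n : sgraph :=
  SGraph (@complete_sym n) (@complete_irrefl n).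

(* [None] is the new vertex, with neighborhood [S]. *)
Definition add_vertex_rel (G : sgraph) (S : {set G}) : rel (option G) :=
  fun x y => match x, y with
    | Some u, Some v => adj u v
    | Some u, None | None, Some u => u \in S
    | None, None => false
    end.

Lemma add_vertex_sym (G : sgraph) (S : {set G}) : symmetric (add_vertex_rel S).
Proof. by move=> [x|] [y|] //=; rewrite adj_sym. Qed.

Lemma add_vertex_irrefl (G : sgraph) (S : {set G}) :
  irreflexive (add_vertex_rel S).
Proof. by move=> [x|] //=; rewrite adj_irrefl. Qed.

Definition add_vertex (G : sgraph) (S : {set G}) : sgraph :=
  SGraph (@add_vertex_sym G S) (@add_vertex_irrefl G S).

Definition pairwise_adjacent (G : sgraph) (S : {set G}) : Prop :=
  {in S &, forall x y, x != y -> adj x y}.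

(* [ktree_iso] makes the notion independent of the names of the vertices. *)
Inductive ktree (k : nat) : sgraph -> Prop :=
| ktree_complete : ktree k (complete_graph k.+1)
| ktree_add_vertex (G : sgraph) (S : {set G}) :
    ktree k G -> #|S| = k -> pairwise_adjacent S -> ktree k (add_vertex S)
| ktree_iso (G H : sgraph) : graph_iso G H -> ktree k G -> ktree k H.

(* Main.v *)
Require Import Defs.
From HB Require Import structures.
From mathcomp Require Import all_boot all_order all_algebra.
From mathcomp Require Import boolp zify.

(** The witness is the join of a complete graph on [p = k - 1] vertices (the
    apexes) with a complete binary tree with [2 ^ h - 1] nodes.  It is a
    [k]-tree: each new tree node is joined to all apexes and to its parent.

    If the colors of the edges at a vertex [v] form an interval, any two of them
    differ by less than the degree of [v] ([interval_span]).  Tree nodes have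
    degree at most [p + 3] ([degree_node]).  Fix an apex [u], which exists as
    [k >= 2].  A tree node and its parent form a triangle with [u], so the colors
    of the two edges from [u] to them differ by at most [2 (p + 2)]
    ([triangle_span]); walking up to the root, the edges from [u] to the tree
    have colors in a range of width linear in [h] ([color_near_root]).  But there
    are [2 ^ h - 1] such edges, so for large [h] some color occurs at [u]
    arbitrarily often. *)

(** * Colors around a vertex of small degree *)

Lemma interval_span (T : finType) (c : T -> int) (A : {set T}) (n : nat)
    (e f : T) :
  integral_interval [seq c x | x in A] -> #|A| <= n.+1 -> e \in A -> f \in A ->
  (`|c e - c f| <= n%:Z)%R.
Proof.
move=> cI A_le; wlog le_ef : e f / (c e <= c f)%R.
  move=> W eA fA.
  have [le_ef|le_fe] : (c e <= c f)%R \/ (c f <= c e)%R by lia.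
    exact: W.
  have := W f e le_fe fA eA; lia.
move=> eA fA; pose d := `|c f - c e|%N.
(* the [d + 1] integers from [c e] to [c f] are all colors of elements of [A] *)
pose s := [seq (c e + i%:Z)%R | i <- iota 0 d.+1].
have s_uniq : uniq s by rewrite map_inj_uniq ?iota_uniq // => i j; lia.
have sub : {subset s <= [seq c x | x in A]}.
  move=> _ /mapP[i + ->]; rewrite mem_iota /d => i_lt.
  by apply: (cI (c e) (c f)); rewrite ?image_f //; lia.
have := uniq_leq_size s_uniq sub.
rewrite size_image size_map size_iota => /leq_trans/(_ A_le).
by rewrite /d; lia.
Qed.

Lemma edge_incident {G : sgraph} {v w : G} :
  adj v w -> [set v; w] \in incident_edges v.
Proof.
move=> vw; rewrite !inE eqxx andbT.
by apply/existsP; exists v; apply/existsP; exists w; rewrite vw eqxx.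
Qed.

Lemma card_incident_edges (G : sgraph) (v : G) :
  #|incident_edges v| <= #|[set w | adj v w]|.
Proof.
apply: leq_trans (leq_imset_card (fun w => [set v; w]) _).
apply/subset_leq_card/fintype.subsetP => e; rewrite !inE => /andP[].
move=> /existsP[x /existsP[y /andP[xy /eqP->]]].
rewrite !inE => /orP[] /eqP ->.
  by apply/imsetP; exists y; rewrite ?inE.
by apply/imsetP; exists x; rewrite ?inE 1?adj_sym // finset.setUC.
Qed.

(** Both edges are compared with the third side [xy] of the triangle. *)
Lemma triangle_span {G : sgraph} {c : {set G} -> int} {d : nat} {u x y : G} :
  improper_interval_coloring c -> adj u x -> adj u y -> adj x y ->
  #|[set w | adj x w]| <= d.+1 -> #|[set w | adj y w]| <= d.+1 ->
  (`|c [set u; x] - c [set u; y]| <= (2 * d)%:Z)%R.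
Proof.
move=> cI ux uy xy dx dy.
have xu : adj x u by rewrite adj_sym.
have yu : adj y u by rewrite adj_sym.
have yx : adj y x by rewrite adj_sym.
have ix := leq_trans (card_incident_edges G x) dx.
have iy := leq_trans (card_incident_edges G y) dy.
have := interval_span _ _ _ _ _ _ (cI x) ix (edge_incident xu) (edge_incident xy).
have := interval_span _ _ _ _ _ _ (cI y) iy (edge_incident yu) (edge_incident yx).
rewrite [[set y; x]]finset.setUC [[set x; u]]finset.setUC [[set y; u]]finset.setUC.
lia.
Qed.

(** * k-trees on initial segments of the natural numbers *)

Section InitialSegments.

Variables (A : rel nat) (A_sym : symmetric A) (A_irrefl : irreflexive A).

Definition segment_graph (n : nat) : sgraph :=
  @SGraph 'I_n (fun i j => A i j) (fun i j => A_sym i j) (fun i => A_irrefl i).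

(** Vertices are added in increasing order; [S n] is the clique to which [n]
    is attached. *)
Lemma segment_graph_ktree (k : nat) (S : nat -> pred nat) :
  (forall i j, i <= k -> j <= k -> A i j = (i != j)) ->
  (forall n i, k < n -> i < n -> A i n = S n i) ->
  (forall n, k < n -> #|[set i : 'I_n | S n i]| = k) ->
  (forall n i j, k < n -> i < n -> j < n -> S n i -> S n j -> i != j -> A i j) ->
  forall n, k < n -> ktree k (segment_graph n).
Proof.
move=> A0 AS S_card S_clique n; elim: n => [//|n IHn]; rewrite ltnS leq_eqVlt.
case/orP => [/eqP <-|kn].
  apply: ktree_iso (ktree_complete k); exists id; first by exists id.
  by move=> x y /=; rewrite A0 //; [exact: ltn_ord x | exact: ltn_ord y].
pose T : {set segment_graph n} := [set i : 'I_n | S n i].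
apply: (@ktree_iso _ (add_vertex T)); last first.
  apply: ktree_add_vertex; [exact: IHn | exact: S_card |].
  by move=> x y; rewrite !inE => Sx Sy xy; apply: S_clique Sx Sy _.
exists (fun x : option 'I_n =>
          if x is Some i then lift ord_max i else ord_max : 'I_n.+1).
  exists (unlift ord_max) => [[x|]|x]; first exact: liftK.
    exact: unlift_none.
  by case: unliftP.
have bumpE (i : 'I_n) : bump n i = i := lift_max i.
move=> [x|] [y|] /=; rewrite ?bumpE ?A_irrefl ?inE //.
  by rewrite AS.
by rewrite A_sym AS.
Qed.

End InitialSegments.

(** * The join of a complete graph with a binary tree *)

(** Vertices below [p] are the apexes, and [p + t] is the tree node number [t] in
    the breadth-first numbering, where the parent of [t > 0] is [(t - 1) / 2].
    For the root and for the apexes the truncated subtraction yields the root as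
    a parent; [cone_rel] discards it by requiring [i < j]. *)
Definition lower_neighbor (p j : nat) : pred nat :=
  fun i => (i < p) || (i == p + (j - p.+1)./2).

Definition cone_rel (p : nat) : rel nat := fun i j =>
  (i < j) && lower_neighbor p j i || (j < i) && lower_neighbor p i j.

Lemma cone_rel_sym p : symmetric (cone_rel p).
Proof. by move=> i j; rewrite /cone_rel orbC. Qed.

Lemma cone_rel_irrefl p : irreflexive (cone_rel p).
Proof. by move=> i; rewrite /cone_rel ltnn. Qed.

Definition cone_graph (p n : nat) : sgraph :=
  segment_graph _ (cone_rel_sym p) (cone_rel_irrefl p) n.

Lemma cone_graph_ktree p n : p.+1 < n -> ktree p.+1 (cone_graph p n).
Proof.
apply: (segment_graph_ktree _ _ _ _ (lower_neighbor p)); rewrite /cone_rel.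
- by move=> i j; rewrite /lower_neighbor; lia.
- by move=> m i; rewrite /lower_neighbor; lia.
- move=> m pm; have le_pm : p <= m by lia.
  have q_lt : p + (m - p.+1)./2 < m by lia.
  (* the clique consists of the parent and the [p] apexes *)
  have -> : [set i : 'I_m | lower_neighbor p m i]
      = Ordinal q_lt |: [set widen_ord le_pm i | i : 'I_p].
    apply/setP => i; rewrite !inE orbC; congr (_ || _).
    apply/idP/imsetP => [ip|[j _ ->]]; last exact: (ltn_ord j).
    by exists (Ordinal ip) => //; apply: val_inj.
  rewrite cardsU1 card_imset ?card_ord; last first.
    by move=> i j /(congr1 val) /= ?; apply: val_inj.
  case: imsetP => [[i _ /(congr1 val) /=]|//]; have := ltn_ord i; lia.
- by move=> m i j; rewrite /lower_neighbor; lia.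
Qed.

Section Cone.

Variables p M : nat.

Definition node (t : 'I_M) : cone_graph p (p + M) := rshift p t.

(** Every neighbor is an apex, the parent or one of the two children. *)
Lemma degree_node (t : 'I_M) : #|[set w | adj (node t) w]| <= p + 3.
Proof.
pose l := iota 0 p ++ [:: p + t.-1./2; p + t.*2.+1; p + t.*2.+2].
have -> : p + 3 = size l by rewrite size_cat size_iota.
rewrite cardE -(size_map val); apply: uniq_leq_size.
  by rewrite map_inj_uniq ?enum_uniq //; apply: val_inj.
move=> _ /mapP[w + ->]; rewrite mem_enum !inE /= /cone_rel /lower_neighbor.
by rewrite mem_cat mem_iota !inE; lia.
Qed.

Variables (u : cone_graph p (p + M)) (u_apex : val u < p).

Lemma adj_apex_node (t : 'I_M) : adj u (node t).
Proof. by rewrite /= /cone_rel /lower_neighbor /=; move: u_apex => /=; lia. Qed.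

(** Induction along the path to the root, one triangle per step: [t.+1 < 2 ^ h]
    says that [t] has depth less than [h], and it passes to the parent with
    [h - 1]. *)
Lemma color_near_root (c : {set cone_graph p (p + M)} -> int) (r : 'I_M) :
  improper_interval_coloring c -> val r = 0 ->
  forall (h : nat) (t : 'I_M), t.+1 < 2 ^ h ->
  (`|c [set u; node t] - c [set u; node r]| <= (h * (2 * (p + 2)))%:Z)%R.
Proof.
move=> cI r0; elim=> [|h IHh] t t_lt; first by rewrite expn0 in t_lt.
have [t0|t_gt0] := posnP t.
  by have -> : t = r by [apply: val_inj; rewrite /= t0 r0]; lia.
have s_lt : t.-1./2 < M by have := ltn_ord t; lia.
pose s := Ordinal s_lt.
have ts : adj (node t) (node s).
  by rewrite /= /cone_rel /lower_neighbor /=; lia.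
have deg x : #|[set w | adj (node x) w]| <= (p + 2).+1.
  by rewrite -addnS degree_node.
have := triangle_span cI (adj_apex_node t) (adj_apex_node s) ts (deg t) (deg s).
have /IHh : s.+1 < 2 ^ h by move: t_lt; rewrite expnS /=; lia.
rewrite mulSn; lia.
Qed.

End Cone.

(** * Counting the edges at an apex *)

Lemma card_le_fibers (T : finType) (L m : nat) (q : T -> 'I_L) :
  (forall j, #|[set t | q t == j]| <= m) -> #|T| <= L * m.
Proof.
move=> q_m; rewrite -sum1_card (partition_big q predT) //=.
rewrite -[L in L * m]card_ord -sum_nat_const; apply: leq_sum => j _.
rewrite sum1_card; apply: leq_trans (q_m j).
by apply/eq_leq/eq_card => t; rewrite !inE.
Qed.

Lemma cone_impropriety (p h m : nat) :
  0 < p -> 0 < h ->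
  has_coloring_of_impropriety (cone_graph p (p + (2 ^ h).-1)) m ->
  (2 ^ h).-1 <= (2 * (h * (2 * (p + 2)))).+1 * m.
Proof.
move=> p_gt0 h_gt0 [c cI cm]; set M := (2 ^ h).-1 in c cI cm *.
have pow_gt1 : 1 < 2 ^ h by rewrite -{1}(expn0 2) ltn_exp2l.
have M_gt0 : 0 < M by rewrite /M; lia.
have n_gt0 : 0 < p + M by lia.
pose u : cone_graph p (p + M) := Ordinal n_gt0.
pose r := Ordinal M_gt0.
pose w := h * (2 * (p + 2)).
have near (t : 'I_M) :
    (`|c [set u; node p M t] - c [set u; node p M r]| <= w%:Z)%R.
  by apply: color_near_root => //; have := ltn_ord t; rewrite /M; lia.
(* the offset of a color from the least possible value [c {u, r} - w] *)
pose q (t : 'I_M) : 'I_((2 * w).+1) :=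
  inord `|(c [set u; node p M t] - c [set u; node p M r] + w%:Z)%R|%N.
rewrite -(card_ord M); apply: (card_le_fibers _ _ _ q) => j.
apply: leq_trans (cm u (c [set u; node p M r] - w%:Z + (val j)%:Z)%R).
have edge_inj : injective (fun t => [set u; node p M t]).
  move=> s t /setP/(_ (node p M s)); rewrite !inE eqxx orbT.
  case/esym/orP => [/eqP/(congr1 val)/=|/eqP/(congr1 val)/= st].
    by lia.
  by apply: val_inj => /=; lia.
rewrite -(card_imset _ edge_inj); apply/subset_leq_card/fintype.subsetP.
move=> _ /imsetP[t + ->]; rewrite inE => /eqP/(congr1 val) /= qt.
rewrite inE (edge_incident (adj_apex_node p M u p_gt0 t)) /=.
move: (near t) qt; rewrite /q.
move: (c [set u; node p M t]) (c [set u; node p M r]) => a b ab.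
by rewrite inordK; lia.
Qed.

(** Squaring [x < 2 ^ x] gives a quadratic lower bound on [2 ^ (2 x)], which
    beats a linear one. *)
Lemma exp_beats_linear (a b : nat) : exists2 h, 0 < h & a * h + b < 2 ^ h.
Proof.
pose x := (2 * a + b).+1; exists (2 * x) => //.
have x_lt : x < 2 ^ x by apply: ltn_expl.
have : x * x <= 2 ^ x * 2 ^ x by apply: leq_mul; apply: ltnW.
rewrite -expnD addnn -mul2n; apply: leq_trans.
by rewrite /x; nia.
Qed.

Theorem theorem1p2 (k : nat) (hk : 2 <= k) (N : nat) (hN : 0 < N) :
  exists G : sgraph, ktree k G /\ N <= mu_int G.
Proof.
case: k hk => [//|p] p_gt0.
have [h h_gt0 h_big] := exp_beats_linear (4 * (p + 2) * N) (N + 2).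
exists (cone_graph p (p + (2 ^ h).-1)); split.
  by apply: cone_graph_ktree; lia.
rewrite /mu_int; case: ex_minnP => m /asboolP /(cone_impropriety _ _ _ p_gt0 h_gt0).
move=> le_m _; rewrite leqNgt; apply/negP => m_lt.
have : (2 * (h * (2 * (p + 2)))).+1 * m <= (2 * (h * (2 * (p + 2)))).+1 * N.
  by apply: leq_mul => //; apply: ltnW.
by move: le_m h_big; nia.
Qed.
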